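(* Let $f(z)$ be a vertex of the tree $\mathcal{T}(z)$. Then there is exactly one choice of $k\in\mathbb{N}_0$, $q_0\in\mathbb{N}_0$ and positive integers $q_1,\dots,q_k$ such that one of the following holds: - $k$ is even and $f(z)=[q_0,q_1,\dots,q_{k-1},q_k+z]$; - $k$ is odd and $f(z)=[q_0,q_1,\dots,q_k,z]$. Only one of the two forms can occur. Moreover, $f(z)$ lies in row $q_0+q_1+\cdots+q_k$ of $\mathcal{T}(z)$.
   Context: Let $z$ be a variable. A positive linear fractional transformation is an expression $w=\frac{az+b}{cz+d}$ with $a,b,c,d\in\mathbb{N}_0=\{0,1,2,\dots\}$ and $ad-bc\neq0$. Its left child is $\frac{w}{w+1}:=\frac{az+b}{(a+c)z+(b+d)}$ and its right child is $w+1:=\frac{(a+c)z+(b+d)}{cz+d}$. Row $0$ of $\mathcal{T}(z)$ is $(z)$. For $n\ge1$, row $n$ consists of the $2^n$ children (left child, then right child) of the entries of row $n-1$, taken in order. The vertices of $\mathcal{T}(z)$ are the entries of all rows. Continued fraction notation: - $[x]=x$; - $[q_0,x_1,\dots,x_m]=q_0+\dfrac{1}{[x_1,\dots,x_m]}$; - $[q_0,\dots,q_{k-1},q_k+z]=q_0+\cfrac{1}{q_1+\cfrac{1}{\ddots+\cfrac{1}{q_k+z}}}$; - $[q_0,\dots,q_k,z]=q_0+\cfrac{1}{q_1+\cfrac{1}{\ddots+\cfrac{1}{q_k+\frac1z}}}$. For $k=0$ the first form is $q_0+z$. Equalities are identities of rational functions in $z$. *)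

(* Defs.v *)
From HB Require Import structures.
From mathcomp Require Import all_boot all_order all_algebra.
From mathcomp Require Import zify.

Set Implicit Arguments.
Unset Strict Implicit.
Unset Printing Implicit Defensive.

Import GRing.Theory.
Local Open Scope ring_scope.

(* The coefficients (a, b, c, d) of the expression (a z + b) / (c z + d). *)
Definition plft_coefs : Type := (nat * nat * nat * nat)%type.

Definition nondegenerate (m : plft_coefs) : bool :=
  let: (a, b, c, d) := m in (a * d != b * c)%N.

Record plft : Type := PLFT {
  coefs :> plft_coefs;
  coefs_nondegenerate : nondegenerate coefs
}.

HB.instance Definition _ := [isSub for coefs].
HB.instance Definition _ := [Equality of plft by <:].

Definition left_coefs (m : plft_coefs) : plft_coefs :=
  let: (a, b, c, d) := m in (a, b, (a + c)%N, (b + d)%N).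

Definition right_coefs (m : plft_coefs) : plft_coefs :=
  let: (a, b, c, d) := m in ((a + c)%N, (b + d)%N, c, d).

Lemma left_nondegenerate (w : plft) : nondegenerate (left_coefs w).
Proof. by case: w => [[[[a b] c] d] /= H]; lia. Qed.

Lemma right_nondegenerate (w : plft) : nondegenerate (right_coefs w).
Proof. by case: w => [[[[a b] c] d] /= H]; lia. Qed.

Definition left_child (w : plft) : plft := PLFT (left_nondegenerate w).
Definition right_child (w : plft) : plft := PLFT (right_nondegenerate w).

Definition plft_z : plft := @PLFT (1, 0, 0, 1)%N isT.

Fixpoint tree_row (n : nat) : seq plft :=
  if n is m.+1 then
    flatten [seq [:: left_child w; right_child w] | w <- tree_row m]
  else [:: plft_z].

Definition is_vertex (w : plft) : Prop := exists n, w \in tree_row n.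

Definition ratfun : fieldType := {fraction {poly rat}}.

Definition z : ratfun := tofrac ('X : {poly rat}).

Definition plft_fun (w : plft) : ratfun :=
  let: (a, b, c, d) := coefs w in
  (a%:R * z + b%:R) / (c%:R * z + d%:R).

(* The value on the empty sequence is a dummy and is never used. *)
Fixpoint contfrac (F : fieldType) (s : seq F) : F :=
  match s with
  | [::] => 0
  | [:: x] => x
  | x :: s' => x + 1 / contfrac s'
  end.

(* Throughout, q is the sequence [:: q_1; ...; q_k], so that belast q0 q is
   [:: q_0; ...; q_(k-1)] and last q0 q is q_k. *)

Definition contfrac_addz (q0 : nat) (q : seq nat) : ratfun :=
  contfrac (rcons [seq i%:R | i <- belast q0 q] ((last q0 q)%:R + z)).

Definition contfrac_z (q0 : nat) (q : seq nat) : ratfun :=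
  contfrac (rcons [seq i%:R | i <- q0 :: q] z).

Definition admissible (k : nat) (q : seq nat) : Prop :=
  size q = k /\ all (fun i => (0 < i)%N) q.

Definition even_form (f : ratfun) (k q0 : nat) (q : seq nat) : Prop :=
  [/\ admissible k q, ~~ odd k & f = contfrac_addz q0 q].

Definition odd_form (f : ratfun) (k q0 : nat) (q : seq nat) : Prop :=
  [/\ admissible k q, odd k & f = contfrac_z q0 q].

Definition cf_form (f : ratfun) (k q0 : nat) (q : seq nat) : Prop :=
  even_form f k q0 q \/ odd_form f k q0 q.

(* Main.v *)
(* Writing L f = f / (f + 1) and R f = f + 1, the vertices of row n are the
   words of length n in L and R applied to z.  Since R^q f = q + f and
   L^q f = 1 / (q + 1 / f), the two continued fraction forms are exactly
   R^q0 L^q1 R^q2 ... z, the last block being made of R's when k is even and of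
   L's when k is odd.  Distinct words give distinct functions, so the statement
   reduces to the uniqueness of the run-length encoding of a word. *)

Require Import Defs.
From mathcomp Require Import all_boot all_order all_algebra.
From mathcomp Require Import zify ring.

Set Implicit Arguments.
Unset Strict Implicit.
Unset Printing Implicit Defensive.

Import GRing.Theory Num.Theory.
Local Open Scope ring_scope.

(** * Comparing coefficients of rational functions *)

Lemma quadratic_z_inj (a b c a' b' c' : nat) :
  a%:R * z ^+ 2 + b%:R * z + c%:R = a'%:R * z ^+ 2 + b'%:R * z + c'%:R ->
  [/\ a = a', b = b' & c = c'].
Proof.
(* Both sides are images of rational polynomials under the injective [tofrac], and naturals embed in
   [rat]. *)
pose P (m n p : nat) : {poly rat} := m%:R *: 'X^2 + n%:R *: 'X + (p%:R)%:P.
have PE m n p : m%:R * z ^+ 2 + n%:R * z + p%:R = tofrac (P m n p) :> ratfun.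
  by rewrite /P /z -!mul_polyC !polyC_natr !(rmorphD, rmorphM, rmorph_nat, rmorphXn).
rewrite !PE => /eqP; rewrite tofrac_eq => /eqP E.
have coefP i := congr1 (fun p : {poly rat} => p`_i) E.
have := (coefP 0%N, coefP 1%N, coefP 2%N).
rewrite /P !coefD !coefZ !coefXn !coefX !coefC /=.
rewrite !(mulr0, mulr1, addr0, add0r) => -[[/eqP + /eqP +] /eqP].
by rewrite !eqr_nat => /eqP-> /eqP-> /eqP->.
Qed.

Lemma linear_z_eq0 (a b : nat) :
  (a%:R * z + b%:R == 0) = (a == 0%N) && (b == 0%N).
Proof.
apply/eqP/andP => [E | [/eqP-> /eqP->]]; last by rewrite mul0r addr0.
have [|_ -> ->] // := @quadratic_z_inj 0 a b 0 0 0.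
by rewrite -addrA E !mul0r !addr0.
Qed.

Lemma plft_den_neq0 (w : plft) :
  let: (a, b, c, d) := coefs w in c%:R * z + d%:R != 0.
Proof. by case: w => [[[[a b] c] d] /= H]; rewrite linear_z_eq0; lia. Qed.

Lemma plft_fun_neq0 w : plft_fun w != 0.
Proof.
rewrite /plft_fun; case: w => [[[[a b] c] d] /= H].
by rewrite mulf_eq0 invr_eq0 !linear_z_eq0; lia.
Qed.

Lemma linear_z_add (a b c d : nat) :
  (a + c)%:R * z + (b + d)%:R = a%:R * z + b%:R + (c%:R * z + d%:R).
Proof. by rewrite !natrD mulrDl addrACA. Qed.

Lemma plft_fun_right w : plft_fun (right_child w) = plft_fun w + 1.
Proof.
have := plft_den_neq0 w; rewrite /plft_fun.
case: w => [[[[a b] c] d] /= H] D.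
by rewrite linear_z_add mulrDl (divff D).
Qed.

Lemma plft_fun_left w : plft_fun (left_child w) = plft_fun w / (plft_fun w + 1).
Proof.
rewrite -plft_fun_right; have := plft_den_neq0 w; rewrite /plft_fun.
case: w => [[[[a b] c] d] /= H] D.
by rewrite linear_z_add invf_div mulrA (divfK D).
Qed.

Lemma plft_fun_z : plft_fun plft_z = z.
Proof. by rewrite /plft_fun /= mul1r mul0r addr0 add0r divr1. Qed.

Lemma linear_mul (F : fieldType) (x : F) (a b c d : nat) :
  (a%:R * x + b%:R) * (c%:R * x + d%:R) =
  (a * c)%:R * x ^+ 2 + (a * d + b * c)%:R * x + (b * d)%:R.
Proof. by rewrite !(natrD, natrM); ring. Qed.

(** Proportional quadruples define the same function, so the coefficients themselves cannot be
    recovered; clearing the nonzero denominators still yields three equations in naturals. *)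
Lemma plft_fun_cross (w w' : plft) : plft_fun w = plft_fun w' ->
  let: (a, b, c, d) := coefs w in let: (a', b', c', d') := coefs w' in
  [/\ a * c' = a' * c, a * d' + b * c' = a' * d + b' * c & b * d' = b' * d]%N.
Proof.
have := plft_den_neq0 w; have := plft_den_neq0 w'; rewrite /plft_fun.
case: w => [[[[a b] c] d] /= H]; case: w' => [[[[a' b'] c'] d'] /= H'] D' D.
move/eqP; rewrite (eqr_div _ _ D D') !linear_mul => /eqP.
exact: quadratic_z_inj.
Qed.

(** * Words of child steps and their values *)

Definition child (b : bool) (w : plft) : plft :=
  if b then right_child w else left_child w.

Definition word_vertex (u : seq bool) : plft := foldr child plft_z u.

(** At positive z a right child exceeds 1 and a left child stays below 1. In coefficients, two sums
    of natural products vanish: a nonzero [a] forces a' = c' = 0, a nonzero [b] forces b' = d' = 0,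
    and a = b = 0 is degenerate as well. *)
Lemma plft_fun_right_neq_left w w' :
  plft_fun (right_child w) <> plft_fun (left_child w').
Proof.
move/plft_fun_cross.
case: w => [[[[a b] c] d] /= H]; case: w' => [[[[a' b'] c'] d'] /= H'] [E _ F].
have {E} : (a * a' + a * c' + c * c' = 0)%N by lia.
have {F} : (b * b' + b * d' + d * d' = 0)%N by lia.
case: a H => [|a]; case: b => [|b] H; case: a' H' => [|a'] H'; nia.
Qed.

Lemma plft_fun_child_neq_z b w : plft_fun (child b w) <> plft_fun plft_z.
Proof.
move/plft_fun_cross.
by case: b; case: w => [[[[a b] c] d] /= H] [E F G]; nia.
Qed.

Lemma plft_fun_child_inj b w w' :
  plft_fun (child b w) = plft_fun (child b w') -> plft_fun w = plft_fun w'.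
Proof.
case: b => /=; first by rewrite !plft_fun_right => /addIr.
rewrite !plft_fun_left => /eqP.
(* The denominators f + 1 are values of right children, hence nonzero. *)
rewrite eqr_div -?plft_fun_right ?plft_fun_neq0 // !plft_fun_right => /eqP E.
apply: (addrI (plft_fun w * plft_fun w')).
by move: E; rewrite !mulrDr !mulr1 [plft_fun w' * _]mulrC.
Qed.

Lemma plft_fun_word_inj : injective (fun u => plft_fun (word_vertex u)).
Proof.
elim=> [|b u IH] [|b' v] //=.
- by move/esym/plft_fun_child_neq_z.
- by move/plft_fun_child_neq_z.
case: (eqVneq b b') => [<- /plft_fun_child_inj /IH -> // | ].
by case: b b' => [] [] //= _; [|move/esym]; move/plft_fun_right_neq_left.
Qed.

Lemma tree_rowP n w :
  reflect (exists2 u, size u = n & w = word_vertex u) (w \in tree_row n).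
Proof.
elim: n w => [|n IH] w /=.
  rewrite inE; apply: (iffP eqP) => [->|[u /size0nil -> ->]] //.
  by exists [::].
apply: (iffP flatten_mapP) => [[v /IH[u <- ->]]|[[|b u] //= [szu] ->]].
  by rewrite !inE => /orP[]/eqP->; [exists (false :: u) | exists (true :: u)].
exists (word_vertex u); first by apply/IH; exists u.
by case: b; rewrite !inE eqxx ?orbT.
Qed.

(** * Run-length encoding *)

Fixpoint runs_word (b : bool) (s : seq nat) : seq bool :=
  if s is q :: s' then nseq q b ++ runs_word (~~ b) s' else [::].

(** The first run is kept apart because it alone may be empty, just as only q_0 may be 0. *)
Fixpoint word_runs (b : bool) (u : seq bool) : nat * seq nat :=
  if u is x :: u' then
    if x == b then let: (p, r) := word_runs b u' in (p.+1, r)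
    else let: (p, r) := word_runs (~~ b) u' in (0%N, p.+1 :: r)
  else (0%N, [::]).

Lemma size_runs_word b s : size (runs_word b s) = sumn s.
Proof. by elim: s b => //= q s IH b; rewrite size_cat size_nseq IH. Qed.

(** Positivity of the later runs matters: an empty one would merge its two neighbours. *)
Lemma runs_wordK b q0 q : all (leq 1) q ->
  word_runs b (runs_word b (q0 :: q)) = (q0, q).
Proof.
elim: q b q0 => [|q1 q IHq] b q0 /=.
  by move=> _; elim: q0 => [//|q0 /= IH]; rewrite eqxx IH.
case: q1 => // q1 /= pos_q; elim: q0 => [|q0 /= IH].
  by rewrite /= -if_neg; have /= -> := IHq (~~ b) q1 pos_q; case: b.
by rewrite eqxx IH.
Qed.

Lemma word_runsK b u :
  runs_word b ((word_runs b u).1 :: (word_runs b u).2) = u.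
Proof.
elim: u b => //= x u IH b; case: eqVneq => [->|].
  by have := IH b; case: (word_runs b u) => p r /= ->.
have := IH (~~ b); case: (word_runs (~~ b) u) => p r /= ->.
by case: x b => [] [].
Qed.

Lemma word_runs_gt0 b u : all (leq 1) (word_runs b u).2.
Proof.
elim: u b => //= x u IH b; case: eqVneq => _.
  by have := IH b; case: (word_runs b u).
by have := IH (~~ b); case: (word_runs (~~ b) u).
Qed.

(** * Continued fractions as values of words *)

Lemma plft_fun_right_run n u :
  plft_fun (word_vertex (nseq n true ++ u)) = n%:R + plft_fun (word_vertex u).
Proof.
elim: n => [|n IH]; first by rewrite add0r.
by rewrite /= plft_fun_right IH -natr1 addrAC.
Qed.

(** On reciprocals a left step is a translation: (f + 1) / f = 1 + 1 / f. *)
Lemma plft_fun_left_run n u :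
  plft_fun (word_vertex (nseq n false ++ u)) =
  1 / (n%:R + 1 / plft_fun (word_vertex u)).
Proof.
suff E : (plft_fun (word_vertex (nseq n false ++ u)))^-1 =
         n%:R + (plft_fun (word_vertex u))^-1 by rewrite !div1r -E invrK.
elim: n => [|n IH]; first by rewrite add0r.
rewrite /= plft_fun_left invf_div mulrDl mulfV ?plft_fun_neq0 // mul1r IH.
by rewrite -natr1 addrCA addrA.
Qed.

Definition cf_value (q0 : nat) (q : seq nat) : ratfun :=
  if odd (size q) then contfrac_z q0 q else contfrac_addz q0 q.

Lemma cf_value_cons2 q0 q1 q2 q :
  cf_value q0 [:: q1, q2 & q] = q0%:R + 1 / (q1%:R + 1 / cf_value q2 q).
Proof.
rewrite /cf_value /= negbK; case: ifP => _ //.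
by rewrite /contfrac_addz; case: q => [|q3 q].
Qed.

(** The induction drops two quotients at a time, one right run and one left run, which preserves
    both the parity of the length and the starting letter. *)
Lemma cf_valueE q0 q :
  cf_value q0 q = plft_fun (word_vertex (runs_word true (q0 :: q))).
Proof.
have [n] := ubnP (size q); elim: n q0 q => // n IH q0 [|q1 [|q2 q]].
- by rewrite /= plft_fun_right_run plft_fun_z.
- by rewrite /= plft_fun_right_run plft_fun_left_run plft_fun_z.
move=> szq; rewrite cf_value_cons2 IH; last by rewrite /= in szq; lia.
by rewrite [in RHS]/= plft_fun_right_run plft_fun_left_run.
Qed.

Lemma cf_formE f k q0 q :
  cf_form f k q0 q <->
  [/\ size q = k, all (leq 1) q
    & f = plft_fun (word_vertex (runs_word true (q0 :: q)))].
Proof.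
rewrite -cf_valueE /cf_value; split.
  by case=> -[[<- pos_q] odd_q ->]; [rewrite (negbTE odd_q) | rewrite odd_q].
by case=> <- pos_q; case: ifP => odd_q ->; [right | left]; split=> //; rewrite odd_q.
Qed.

(** Injectivity on words turns an equality of functions into an equality of words, whose encoding is
    unique; existence, uniqueness and the row number all follow from this equivalence. *)
Lemma cf_form_word u k q0 q :
  cf_form (plft_fun (word_vertex u)) k q0 q <->
  (k, (q0, q)) = (size (word_runs true u).2, word_runs true u).
Proof.
rewrite cf_formE; split=> [[<- pos_q /plft_fun_word_inj ->]|].
  by rewrite runs_wordK.
case: (word_runs true u) (word_runsK true u) (word_runs_gt0 true u) => p r.
by move=> <- pos_r [-> -> ->].
Qed.

Theorem mainTheorem9 (w : plft) (hw : is_vertex w) :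
  [/\ exists! t : nat * nat * seq nat,
        let: (k, q0, q) := t in cf_form (plft_fun w) k q0 q,
      ~ ((exists k q0 q, even_form (plft_fun w) k q0 q) /\
         (exists k q0 q, odd_form (plft_fun w) k q0 q))
    & forall (k q0 : nat) (q : seq nat),
        cf_form (plft_fun w) k q0 q -> w \in tree_row (q0 + sumn q)].
Proof.
case: hw => n /tree_rowP[u _ ->]; split.
- case E: (word_runs true u) => [p r].
  exists (size r, p, r); split=> [|[[k q0] q]]; first by apply/cf_form_word; rewrite E.
  by move/cf_form_word; rewrite E => -[-> -> ->].
- case=> -[k [q0 [q even_q]]] [k' [q0' [q' odd_q]]].
  have /cf_form_word[kE _] := or_introl even_q : cf_form _ _ _ _.
  have /cf_form_word[kE' _] := or_intror odd_q : cf_form _ _ _ _.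
  (* Both lengths equal the number of runs after the first, so their parities cannot differ. *)
  by case: even_q odd_q => _ + _ [_ + _]; rewrite kE kE' => /negbTE->.
move=> k q0 q /cf_form_word[_ E]; apply/tree_rowP; exists u => //.
(* The row is the length of [u], that is, the sum of its run lengths. *)
by rewrite -[in LHS](word_runsK true u) size_runs_word -E.
Qed.
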